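(* Let $g(m)$ denote the number of unit Fubini rankings of length $m$. Then $g(1)=1$, $g(2)=3$, and for every $n\ge 2$, $$g(n+1)=(n+1)\,g(n)+\binom{n+1}{2}g(n-1).$$
   Context: $[n]=\{1,\ldots,n\}$. Parking process: $\alpha=(a_1,\ldots,a_n)\in[n]^n$ encodes preferences of cars $1,\ldots,n$ arriving in order at a one-way street with spots $1,\ldots,n$; car $i$ parks in spot $a_i$ if free, otherwise in the first free spot after $a_i$, if any. $\alpha$ is a parking function if all cars park. A unit interval parking function is a parking function in which each car $i$ parks in spot $a_i$ or $a_i+1$. A Fubini ranking is a tuple $(r_1,\ldots,r_n)\in[n]^n$ with $r_i=1+|\{j:r_j<r_i\}|$ for all $i$. A unit Fubini ranking is a tuple that is both a Fubini ranking and a unit interval parking function. *)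

(* Defs.v *)
From mathcomp Require Import all_boot.

Set Implicit Arguments.
Unset Strict Implicit.
Unset Printing Implicit Defensive.

(* A tuple in [n]^n is an n.-tuple 'I_n; since 'I_n is {0, ..., n-1}, the
   ordinal x stands for the number x.+1.  Cars are indexed from 0 by 'I_n,
   but preferences, ranks and spots below are numbered from 1 to n. *)
Definition entry (n : nat) (a : n.-tuple 'I_n) (i : 'I_n) : nat :=
  (tnth a i).+1.

(* The first spot of a, a+1, ..., n that is not in occ, if there is one. *)
Definition park (n : nat) (occ : seq nat) (a : nat) : option nat :=
  ohead [seq s <- iota a (n.+1 - a) | s \notin occ].

(* The spots taken by cars with successive preferences prefs, arriving when the
   spots in occ are occupied; None marks a car that fails to park, and such a
   car leaves the street unchanged. *)
Fixpoint parking_process (n : nat) (occ : seq nat) (prefs : seq nat) :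
    seq (option nat) :=
  if prefs is a :: prefs' then
    let s := park n occ a in
    s :: parking_process n (if s is Some t then t :: occ else occ) prefs'
  else [::].

Definition spot (n : nat) (a : n.-tuple 'I_n) (i : 'I_n) : option nat :=
  nth None (parking_process n [::] [seq entry a j | j <- enum 'I_n]) i.

Definition parking_function (n : nat) (a : n.-tuple 'I_n) : bool :=
  [forall i : 'I_n, isSome (spot a i)].

Definition unit_interval_parking_function (n : nat) (a : n.-tuple 'I_n) : bool :=
  parking_function a &&
  [forall i : 'I_n,
     (spot a i == Some (entry a i)) || (spot a i == Some (entry a i + 1))].

Definition fubini_ranking (n : nat) (r : n.-tuple 'I_n) : bool :=
  [forall i : 'I_n,
     entry r i == 1 + #|[set j : 'I_n | entry r j < entry r i]|].

Definition unit_fubini_ranking (n : nat) (r : n.-tuple 'I_n) : bool :=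
  fubini_ranking r && unit_interval_parking_function r.

Definition num_unit_fubini_rankings (m : nat) : nat :=
  #|[set r : m.-tuple 'I_m | unit_fubini_ranking r]|.

(* Main.v *)
(** In a Fubini ranking the cars with rank [v] are the only ones to use the
    spots [v], [v + 1], ..., and they fill them in their order of arrival.  So
    a Fubini ranking is a unit interval parking function iff no rank is taken
    more than twice.  Deleting the one or two entries of largest rank leaves a
    ranking of the same kind on the remaining indices, and the deleted entries
    are recovered from their positions alone; choosing those positions gives
    the two terms of the recurrence. *)
Require Import Defs.
From mathcomp Require Import all_boot zify.

Set Implicit Arguments.
Unset Strict Implicit.
Unset Printing Implicit Defensive.

(** * Where cars park under a Fubini ranking *)

Lemma park_first n occ a c :
  (forall s, a <= s < a + c -> s \in occ) -> a + c \notin occ -> a + c <= n ->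
  park n occ a = Some (a + c).
Proof.
move=> occ_lt free le_n; rewrite /park.
have -> : n.+1 - a = c + (n - (a + c)).+1 by lia.
rewrite iotaD filter_cat (eq_in_filter (a2 := pred0)) => [|s].
  by rewrite filter_pred0 /= free.
by rewrite mem_iota => /occ_lt ->.
Qed.

Definition fubini_seq (p : seq nat) : Prop :=
  forall x, x \in p -> x = 1 + count (fun y => y < x) p.

Lemma count_lt_eq (p : seq nat) v :
  count (fun y => y < v) p + count_mem v p = count (fun y => y <= v) p.
Proof. by elim: p => //= y p <-; case: (ltngtP y v) => _ /=; lia. Qed.

(** There are [w - 1] entries below [w], and they include every entry at most [v]: the [v - 1]
    entries below [v] and all copies of [v]. *)
Lemma fubini_gap p v w : fubini_seq p -> v \in p -> w \in p -> v < w ->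
  v + count_mem v p <= w.
Proof.
move=> fub vp wp ltvw; rewrite {1}(fub v vp) (fub w wp) -addnA count_lt_eq.
by rewrite leq_add2l; apply: sub_count => y /= /leq_ltn_trans; apply.
Qed.

(** Induction on the cars [q2] still to come, [q1] being those already parked. Invariant: the
    occupied spots form one interval for each rank [v] used in [q1], starting at [v] and as long as
    [v] has copies there. [fubini_gap] keeps these intervals disjoint, so a car is displaced only by
    earlier cars of its own rank. *)
Lemma parking_process_fubini p q1 q2 occ :
  fubini_seq p -> p = q1 ++ q2 ->
  (forall s, reflect (exists2 v, v \in q1 & v <= s < v + count_mem v q1)
                     (s \in occ)) ->
  forall i, i < size q2 ->
  nth None (parking_process (size p) occ q2) i =
    Some (nth 0 q2 i + count_mem (nth 0 q2 i) (q1 ++ take i q2)).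
Proof.
move=> fub; elim: q2 q1 occ => // a q2 IH q1 occ def_p occP.
have ap : a \in p by rewrite def_p mem_cat mem_head orbT.
set c := count_mem a q1.
have c_lt : c < count_mem a p by rewrite def_p count_cat /= eqxx -/c; lia.
have sub1 v : count_mem v q1 <= count_mem v p.
  by rewrite def_p count_cat leq_addr.
have mem1 v : v \in q1 -> v \in p by rewrite def_p mem_cat => ->.
have parkE : park (size p) occ a = Some (a + c).
  apply: park_first => [s lt_s||].
  - apply/occP; exists a => //; rewrite -has_pred1 has_count -/c; lia.
  - apply/negP => /occP[v vq1 lt_v].
    have [ltav|ltva|eq_av] := ltngtP a v.
    + have := fubini_gap fub ap (mem1 _ vq1) ltav; lia.
    + have := fubini_gap fub (mem1 _ vq1) ap ltva; have := sub1 v; lia.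
    + by move: lt_v; rewrite -eq_av -/c; lia.
  (* The street is long enough: [a] plus its multiplicity in [p] is one more than the number of
     entries at most [a], and [c] is smaller than that multiplicity. *)
  - have := count_lt_eq p a; have := fub a ap.
    have := count_size (fun y => y <= a) p; lia.
case=> [|i] /= lt_i; first by rewrite parkE cats0.
rewrite parkE; rewrite (IH (rcons q1 a)) //; last first.
- move=> s; rewrite inE; apply: (iffP orP) => [[/eqP->|/occP[v vq1 lt_v]]|].
  + exists a; first by rewrite mem_rcons mem_head.
    by rewrite -cats1 count_cat /= eqxx -/c; lia.
  + exists v; first by rewrite mem_rcons inE vq1 orbT.
    by rewrite -cats1 count_cat; lia.
  (* Parking [a] lengthens only the interval of [a], and only by the spot [a + c]. *)
  + case=> v; rewrite mem_rcons inE -cats1 count_cat /= addn0 => vq1 lt_v.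
    have [/eqP->|ne_s] := boolP (s == a + c); [by left | right].
    apply/occP; exists v.
      case/orP: vq1 => [/eqP eq_va|//]; rewrite -has_pred1 has_count.
      by move: lt_v ne_s; rewrite eq_va eqxx -/c; lia.
    move: lt_v ne_s; case: eqP => [<-|_] /=; last by rewrite addn0.
    rewrite -/c => lt_s /eqP ne_s; lia.
- by rewrite cat_rcons.
by rewrite cat_rcons.
Qed.

(** The last copy of a value is preceded by all its other copies, so bounding the earlier copies by
    [k] bounds the multiplicity by [k.+1]. *)
Lemma count_mem_take_leq (p : seq nat) k :
  (forall i, i < size p -> count_mem (nth 0 p i) (take i p) <= k) <->
  (forall v, count_mem v p <= k.+1).
Proof.
split=> [|le_k i lt_i]; last first.
  have := le_k (nth 0 p i); rewrite -{2}(cat_take_drop i p) count_cat.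
  by rewrite (drop_nth 0 lt_i) /= eqxx; lia.
elim/last_ind: p => [//|p x IH] le_k v; rewrite -cats1 count_cat /= addn0.
case: eqP => [<-|_] /=.
  have := le_k (size p); rewrite size_rcons nth_rcons ltnn eqxx -cats1.
  by rewrite take_size_cat // => /(_ (ltnSn _)); rewrite addn1.
rewrite addn0; apply: IH => i lt_i; have := le_k i.
rewrite size_rcons nth_rcons lt_i -cats1 takel_cat ?(ltnW lt_i) //.
by apply; apply: ltnW.
Qed.

(** * Unit Fubini rankings as Fubini rankings with multiplicities at most two *)

Definition entries n (r : n.-tuple 'I_n) := [seq entry r j | j <- enum 'I_n].

Lemma size_entries n (r : n.-tuple 'I_n) : size (entries r) = n.
Proof. by rewrite size_map size_enum_ord. Qed.

Lemma nth_entries n (r : n.-tuple 'I_n) (i : 'I_n) :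
  nth 0 (entries r) i = entry r i.
Proof. by rewrite (nth_map i) ?size_enum_ord // nth_ord_enum. Qed.

Lemma count_entries n (r : n.-tuple 'I_n) (P : pred nat) :
  count P (entries r) = #|[set j | P (entry r j)]|.
Proof.
rewrite count_map cardE -size_filter; congr size.
by rewrite {2}/enum_mem -enumT; apply: eq_filter => j; rewrite /= inE.
Qed.

Lemma fubini_entries n (r : n.-tuple 'I_n) :
  fubini_ranking r -> fubini_seq (entries r).
Proof.
by move=> /forallP fub _ /mapP[i _ ->]; rewrite count_entries; apply/eqP.
Qed.

Lemma spot_fubini n (r : n.-tuple 'I_n) (i : 'I_n) : fubini_ranking r ->
  spot r i = Some (entry r i + count_mem (entry r i) (take i (entries r))).
Proof.
move=> /fubini_entries fub.
have := @parking_process_fubini (entries r) [::] (entries r) [::] fub erefl _ i.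
rewrite size_entries nth_entries /spot -/(entries r) => -> //.
by move=> s; apply: (iffP idP) => // -[].
Qed.

(** The displacement of a car is the number of earlier cars of its rank, so all displacements are at
    most 1 exactly when no rank has more than two copies. *)
Lemma unit_fubiniE n (r : n.-tuple 'I_n) :
  unit_fubini_ranking r =
  fubini_ranking r &&
  [forall i, #|[set j | entry r j == entry r i]| <= 2].
Proof.
rewrite /unit_fubini_ranking; apply: andb_id2l => fub.
rewrite /unit_interval_parking_function.
have -> : parking_function r by apply/forallP => i; rewrite spot_fubini.
apply/forallP/forallP => /= [unit i|le2 i].
  rewrite -(count_entries r (pred1 _)).
  apply: (iffLR (count_mem_take_leq _ _)) => k; rewrite size_entries => ltk.
  have := unit (Ordinal ltk); rewrite spot_fubini //.
  rewrite (nth_entries r (Ordinal ltk)) /=.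
  by case: count => [|[|c]] // /orP[] /eqP[]; lia.
have: count_mem (entry r i) (take i (entries r)) <= 1.
  rewrite -nth_entries; apply: (iffRL (count_mem_take_leq _ _)); last first.
    by rewrite size_entries.
  move=> v.
  have [/mapP[j _ ->]|/count_memPn->//] := boolP (v \in entries r).
  by rewrite count_entries; apply: le2.
rewrite spot_fubini //; case: count => [|[|//]] _; apply/orP; [left|right] => //.
by rewrite addn0.
Qed.

(** * Rankings of a subset and removal of the top block *)

Section PartialRankings.

Variables (T : finType) (m : nat).
Implicit Types (A S : {set T}) (f : {ffun T -> 'I_m.+1}).

(* Ranks start at 0 here; the value 0 outside [A] makes a ranking of [A]
   determine the whole function. *)
Definition unit_ranking A f :=
  [&& [forall x in A, f x == #|[set y in A | f y < f x]| :> nat],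
      [forall x in A, #|[set y in A | f y == f x]| <= 2]
    & [forall x in ~: A, f x == ord0]].

Definition top_block A f := [set x in A | [forall y in A, f y <= f x]].

(** A block placed on top of [A :\: S] has exactly [#|A :\: S|] elements below it, which is its rank
    counted from 0. *)
Definition add_top A S f : {ffun T -> 'I_m.+1} :=
  [ffun x => if x \in S then inord #|A :\: S| else f x].

Lemma unit_rankingP A f :
  reflect [/\ forall x, x \in A -> f x = #|[set y in A | f y < f x]| :> nat,
              forall x, x \in A -> #|[set y in A | f y == f x]| <= 2
            & forall x, x \notin A -> f x = ord0]
          (unit_ranking A f).
Proof.
apply: (iffP and3P) => -[/= rk le2 out]; split.
- by move=> x xA; apply/eqP; apply: (forall_inP rk).
- exact/forall_inP.
- by move=> x xA; apply/eqP; apply: (forall_inP out); rewrite inE.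
- by apply/forall_inP => x xA; apply/eqP/rk.
- exact/forall_inP.
- by apply/forall_inP => x; rewrite inE => xA; apply/eqP/out.
Qed.

Lemma top_block_card A f : unit_ranking A f -> A != set0 ->
  0 < #|top_block A f| <= 2.
Proof.
case/unit_rankingP => _ le2 _ /set0Pn[x0 x0A].
have [x xA x_max] := @arg_maxnP T x0 [in A] (fun x => f x) x0A.
have xtop : x \in top_block A f by rewrite inE [_ \in A]xA; apply/forall_inP.
rewrite card_gt0; apply/andP; split; first by apply/set0Pn; exists x.
apply: leq_trans (le2 x xA); apply/subset_leq_card/subsetP => y.
rewrite !inE => /andP[yA /forall_inP /(_ x xA) lexy]; rewrite yA /=.
by rewrite -val_eqE eqn_leq lexy andbT; apply: x_max.
Qed.

Lemma rank_lt A f x : unit_ranking A f -> x \in A -> f x < #|A|.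
Proof.
case/unit_rankingP => rk _ _ xA; rewrite rk //; apply/proper_card/properP.
split; first by apply/subsetP => y; rewrite inE => /andP[].
by exists x; rewrite // inE ltnn andbF.
Qed.

(** By [rank_lt] the ranks on [A :\: S] stay below [#|A :\: S|], so the new block lies strictly
    above them and changes none of their counts. *)
Lemma add_top_unit_ranking A S f : S \subset A -> 0 < #|S| <= 2 ->
  #|A| <= m.+1 -> unit_ranking (A :\: S) f ->
  unit_ranking A (add_top A S f) && (top_block A (add_top A S f) == S).
Proof.
move=> sSA /andP[S_gt0 S_le2] leA ranked.
have lt_f x : x \in A -> x \notin S -> f x < #|A :\: S|.
  by move=> xA xS; apply: rank_lt; rewrite // inE xS.
have [rk le2 out] := unit_rankingP _ _ ranked.
have [z zS] : exists z, z \in S by apply/set0Pn; rewrite -card_gt0.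
(* [S] is nonempty and [#|A| <= m.+1], so the new rank fits in ['I_m.+1] and [inord] does not
   truncate. *)
have valS : (inord #|A :\: S| : 'I_m.+1) = #|A :\: S| :> nat.
  rewrite inordK //; apply: leq_trans leA.
  have := cardsD A S; rewrite (setIidPr sSA); have := subset_leq_card sSA; lia.
apply/andP; split.
  apply/unit_rankingP; split=> x xA.
  - rewrite ffunE; case: ifPn => xS.
      rewrite [LHS]valS; apply: eq_card => y; rewrite !inE ffunE.
      case yA: (y \in A); rewrite ?andbF //.
      by case: ifPn => yS /=; rewrite valS ?ltnn ?lt_f.
    rewrite [LHS]rk ?inE ?xS //; apply: eq_card => y; rewrite !inE ffunE.
    case yA: (y \in A); rewrite ?andbF //=.
    by case: ifPn => yS //=; rewrite valS ltnNge ltnW ?lt_f.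
  - rewrite ffunE; case: ifPn => xS.
      apply: leq_trans S_le2; apply/subset_leq_card/subsetP => y.
      rewrite !inE ffunE; case: ifPn => // yS /andP[yA].
      by rewrite -val_eqE /= valS ltn_eqF ?lt_f.
    apply: leq_trans (le2 x _); rewrite ?inE ?xS //.
    apply/subset_leq_card/subsetP => y; rewrite !inE ffunE.
    case: ifPn => // yS /andP[yA].
    by rewrite -val_eqE /= valS gtn_eqF ?lt_f.
  - rewrite ffunE ifN ?out ?inE ?(negPf xA) ?andbF //.
    by apply: contra xA; apply: (subsetP sSA).
apply/eqP/setP => x; rewrite inE; apply/andP/idP => [[xA /forall_inP max_x]|xS].
  apply: contraLR (max_x z (subsetP sSA _ zS)) => xS.
  by rewrite !ffunE zS (negPf xS) valS -ltnNge lt_f.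
split; first exact: (subsetP sSA).
apply/forall_inP => y yA; rewrite !ffunE xS.
by case: ifPn => // yS; rewrite valS ltnW ?lt_f.
Qed.

(** An element of the top block has all of [A :\: S] and nothing of [S] strictly below it, so its
    rank is forced. *)
Lemma top_block_add_top A f : unit_ranking A f ->
  let S := top_block A f in
  exists2 g, unit_ranking (A :\: S) g & f = add_top A S g.
Proof.
case/unit_rankingP => rk le2 out S.
have below x y : x \in A -> x \notin S -> y \in S -> f x < f y.
  move=> xA; rewrite !inE xA /= => /forall_inPn[z zA].
  by rewrite -ltnNge => ltz /andP[_ /forall_inP/(_ z zA)]; apply: leq_trans.
have topS x y : x \in A -> y \in S -> f x <= f y.
  by move=> xA; rewrite inE => /andP[_ /forall_inP]; apply.
have sSA x : x \in S -> x \in A by rewrite inE => /andP[].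
(* Only [below], [topS] and [sSA] are needed from here on. The witness is 0 on [S], as required
   outside [A :\: S]. *)
clearbody S; exists [ffun x => if x \in S then ord0 else f x].
  apply/unit_rankingP; split=> x; rewrite inE ?negb_and ?negbK.
  - case/andP => xS xA; rewrite ffunE (negPf xS) [LHS]rk //.
    apply: eq_card => y; rewrite !in_set ffunE.
    case yA: (y \in A); rewrite ?andbF // andbT.
    case: (boolP (y \in S)) => yS //=.
    by rewrite ltnNge ltnW ?below.
  - case/andP => xS xA; apply: leq_trans (le2 x xA).
    apply/subset_leq_card/subsetP => y; rewrite !in_set !ffunE (negPf xS).
    by case/andP=> /andP[/negPf-> ->].
  - by rewrite ffunE; case: (x \in S) => //= xA; apply: out.
apply/ffunP => x; rewrite !ffunE; case: (boolP (x \in S)) => // xS.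
suff <- : f x = #|A :\: S| :> nat by rewrite inord_val.
rewrite [LHS]rk ?sSA //; apply: eq_card => y; rewrite !in_set.
case yA: (y \in A); rewrite ?andbF // andbT /=.
case: (boolP (y \in S)) => yS; last exact: below.
by rewrite ltnNge topS ?sSA.
Qed.

Definition unit_rankings A := [set f | unit_ranking A f].

Lemma card_top_block A S : S \subset A -> 0 < #|S| <= 2 -> #|A| <= m.+1 ->
  #|[set f in unit_rankings A | top_block A f == S]| = #|unit_rankings (A :\: S)|.
Proof.
move=> sSA cardS leA.
have -> : [set f in unit_rankings A | top_block A f == S]
          = add_top A S @: unit_rankings (A :\: S).
  apply/setP => f; rewrite !inE; apply/idP/imsetP.
    case/andP => /top_block_add_top[g rg fE] /eqP eqS.
    by exists g; rewrite ?inE -eqS.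
  by case=> g; rewrite inE => rg ->; apply: add_top_unit_ranking.
(* Injectivity: off [S] the map [add_top] keeps the values, and on [S] both rankings are 0 by
   convention. *)
apply: card_in_imset => f g; rewrite !inE => /unit_rankingP[_ _ outf].
case/unit_rankingP=> _ _ outg /ffunP eq_fg; apply/ffunP => x.
have := eq_fg x; rewrite !ffunE; case: ifP => // xS _.
by rewrite outf ?outg // inE xS.
Qed.

Lemma card_unit_rankings_rec A : A != set0 -> #|A| <= m.+1 ->
  #|unit_rankings A| =
  \sum_(S : {set T} | (S \subset A) && (0 < #|S| <= 2)) #|unit_rankings (A :\: S)|.
Proof.
move=> A0 leA; rewrite -sum1_card.
rewrite (partition_big (top_block A)
          (fun S => (S \subset A) && (0 < #|S| <= 2))) /=; last first.
  move=> f; rewrite inE => rf; rewrite top_block_card // andbT.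
  by apply/subsetP => x; rewrite inE => /andP[].
apply: eq_bigr => S /andP[sSA cardS]; rewrite -card_top_block // -sum1_card.
by apply: eq_bigl => f; rewrite !inE.
Qed.

End PartialRankings.

(** * The recurrence and its transfer to tuples *)

Fixpoint unit_fubini_rec (n : nat) : nat :=
  match n with
  | 0 => 1
  | n1.+1 => if n1 is n2.+1 then
      n1.+1 * unit_fubini_rec n1 + 'C(n1.+1, 2) * unit_fubini_rec n2 else 1
  end.

(** Strong induction on [#|A|]: the sum over top blocks splits into singletons and pairs, and each
    summand depends only on the size of what remains. *)
Lemma card_unit_rankings (T : finType) (m : nat) (A : {set T}) : #|A| <= m.+1 ->
  #|unit_rankings m A| = unit_fubini_rec #|A|.
Proof.
have [k] := ubnP #|A|; elim: k A => // k IH A ltA leA.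
(* The empty set has one ranking, the constant 0 function. *)
have [->|A0] := eqVneq A set0.
  rewrite cards0 /=; apply/eqP/cards1P; exists [ffun=> ord0].
  apply/setP => f; rewrite !inE; apply/unit_rankingP/eqP => [[_ _ out]|->].
    by apply/ffunP => x; rewrite ffunE out ?inE.
  by split=> x; rewrite ?inE ?ffunE.
rewrite card_unit_rankings_rec //.
have sum_card j : 0 < j <= 2 ->
  \sum_(S : {set T} | (S \subset A) && (#|S| == j)) #|unit_rankings m (A :\: S)|
  = 'C(#|A|, j) * unit_fubini_rec (#|A| - j).
  move=> j12; rewrite -cards_draws -sum_nat_const.
  apply: eq_big => [S|S /andP[sSA /eqP cardS]]; first by rewrite !inE.
  have cardAS : #|A :\: S| = #|A| - j by rewrite cardsD (setIidPr sSA) cardS.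
  have := subset_leq_card sSA; rewrite cardS => leSA.
  by rewrite IH cardAS //; lia.
rewrite (bigID (fun S : {set T} => #|S| == 1)) /=.
rewrite (eq_bigl (fun S : {set T} => (S \subset A) && (#|S| == 1))); last first.
  by move=> S; case: eqP => [->|]; rewrite ?andbF ?andbT.
rewrite [X in _ + X](eq_bigl (fun S : {set T} => (S \subset A) && (#|S| == 2))); last first.
  by move=> S; case: #|S| => [|[|[|]]] *; rewrite ?andbF ?andbT.
rewrite !sum_card //; move: A0; rewrite -card_gt0.
(* When [#|A|] is 1 the pair term vanishes because ['C(1, 2)] is 0. *)
by case: #|A| => [|[|a]] // _; rewrite bin1 !subSS ?subn0.
Qed.

Lemma num_unit_fubini_rankingsE n :
  num_unit_fubini_rankings n.+1 = unit_fubini_rec n.+1.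
Proof.
rewrite -[n.+1 in RHS]card_ord -cardsT -(@card_unit_rankings _ n) ?cardsT ?card_ord //.
(* Tuples correspond to rankings of the full set; entries exceed values of [F] by 1, which affects
   neither comparisons nor multiplicities. *)
pose F (r : n.+1.-tuple 'I_n.+1) := [ffun i => tnth r i].
have F_inj : injective F.
  by move=> r s /ffunP eqF; apply: eq_from_tnth => i; have := eqF i; rewrite !ffunE.
rewrite /num_unit_fubini_rankings -(card_imset _ F_inj); apply: eq_card => f.
have -> : f = F [tuple f i | i < n.+1].
  by apply/ffunP => i; rewrite ffunE tnth_mktuple.
rewrite mem_imset // !inE unit_fubiniE; move: [tuple _ | _ < _] => r.
have ltE i : [set j in setT | F r j < F r i] = [set j | entry r j < entry r i].
  by apply/setP => j; rewrite !inE !ffunE.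
have eqE i : [set j in setT | F r j == F r i] = [set j | entry r j == entry r i].
  by apply/setP => j; rewrite !inE !ffunE -val_eqE /entry eqSS.
apply/andP/unit_rankingP => [[/forallP fub /forallP le2]|[rk le2 _]].
  split=> i; rewrite ?inE // => _; last by rewrite eqE.
  by rewrite ltE ffunE; have /eqP[] := fub i.
split; apply/forallP => i; last by rewrite -eqE le2 ?inE.
by rewrite -ltE -rk ?inE // ffunE.
Qed.

Theorem theorem5p2 :
  num_unit_fubini_rankings 1 = 1 /\
  num_unit_fubini_rankings 2 = 3 /\
  forall n : nat, 2 <= n ->
    num_unit_fubini_rankings n.+1 =
      n.+1 * num_unit_fubini_rankings n
      + 'C(n.+1, 2) * num_unit_fubini_rankings n.-1.
Proof.
split; first by rewrite num_unit_fubini_rankingsE.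
split; first by rewrite num_unit_fubini_rankingsE.
(* For [n >= 2] all three lengths are positive, as [num_unit_fubini_rankingsE] requires. *)
by case=> [|[|n]] // _; rewrite !num_unit_fubini_rankingsE.
Qed.
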